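(* Let $\{\lambda_i\}_{i=1}^\infty$ be a sequence of strictly positive numbers with $\{\lambda_i\}_{i=1}^\infty\in\ell^2$, and let $\mathfrak{g}_\infty$ be the Lie algebra generated by the orthonormal basis $\xi_{ij}=\lambda_i\lambda_je_{ij}$, $i<j$. Then for large $N$ $$\hat R^N(\xi_{km})=b^N_{km}\xi_{km},$$ where $b^N_{km}\to-\infty$ as $N\to\infty$.
   Context: $H$ is a real separable infinite-dimensional Hilbert space, $HS$ the space of Hilbert-Schmidt operators on $H$, viewed as infinite matrices $\{a_{ij}\}_{i,j=1}^\infty$ with $\sum_{i,j}|a_{ij}|^2<\infty$; $e_{ij}$ is the matrix with $1$ at the $ij$th place and $0$ elsewhere. $\mathfrak{g}_\infty$ is the subspace of $HS$ consisting of the sums $\sum_{i<j} x_{ij}\xi_{ij}$ with $\sum x_{ij}^2<\infty$, with the inner product $(\cdot,\cdot)$ making $\{\xi_{ij}\}_{i<j}$ an orthonormal basis and with the operator commutator as Lie bracket: $[\xi_{ij},\xi_{km}]=\delta_{j,k}\lambda_j^2\xi_{im}-\delta_{i,m}\lambda_i^2\xi_{kj}$ for $i<j$, $k<m$ ($\delta$ is Kronecker's symbol), with the convention $\xi_{ij}=0$ if $i\geqslant j$. The Levi-Civita connection is defined by $(\nabla_xy,z)=\frac12\big(([x,y],z)-([y,z],x)+([z,x],y)\big)$; the Riemannian curvature tensor by $R_{xy}=\nabla_{[x,y]}-\nabla_x\nabla_y+\nabla_y\nabla_x$; the truncated self-adjoint Ricci curvature (transformation) is $\hat R^N(x)=\sum_{i<j\leqslant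 N}R_{\xi_{ij}x}(\xi_{ij})$. Here $k<m$ are fixed. *)

(* Defs.v *)
From mathcomp Require Import all_boot all_order all_algebra.
From mathcomp Require Import all_classical all_reals all_analysis.
Set Implicit Arguments.
Unset Strict Implicit.
Unset Printing Implicit Defensive.
Import Order.TTheory GRing.Theory Num.Theory numFieldNormedType.Exports.
Local Open Scope classical_set_scope.
Local Open Scope ring_scope.

(* Operators on the Hilbert space are given by their matrices in a fixed
   orthonormal basis.  Rows and columns are numbered from 0, so the indices
   1, ..., N of the usual numbering are the naturals i < N.  Functions
   nat -> nat -> R carry the pointwise vector-space structure. *)
Notation infmx R := (nat -> nat -> R).

Section HilbertSchmidt.
Variable R : realType.
Implicit Types A B : infmx R.

Definition sqsum_on (D : set (nat * nat)) A : Prop :=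
  (\esum_(p in D) ((`|A p.1 p.2| ^+ 2)%:E : \bar R) < +oo)%E.

Definition HS : set (infmx R) := [set A | sqsum_on setT A].

Definition unitmat (i j : nat) : infmx R :=
  fun a b => ((a == i) && (b == j))%:R.

Definition mxprod A B : infmx R :=
  fun i j => limn (series (fun l => A i l * B l j)).

Definition lie A B : infmx R := mxprod A B - mxprod B A.

End HilbertSchmidt.

Section LieAlgebra.
Variables (R : realType) (lam : nat -> R).
Implicit Types (x y z v : infmx R) (N : nat).

Definition xi (i j : nat) : infmx R :=
  if (i < j)%N then (lam i * lam j) *: unitmat R i j else 0.

(* The sum of the c i j *: xi i j over i < j.  Its convergence is entrywise,
   each entry having at most one nonzero term; for square-summable c and
   bounded lam it also converges in the Hilbert-Schmidt norm. *)
Definition xisum (c : nat -> nat -> R) : infmx R :=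
  fun a b => limn (fun n : nat =>
    \sum_(j < n) \sum_(i < n | (i < j)%N) c i j * xi i j a b).

Definition ginf : set (infmx R) :=
  [set x | HS x /\
    exists2 c : infmx R,
      sqsum_on [set p : nat * nat | (p.1 < p.2)%N] c & x = xisum c].

(* The coefficient of x on xi i j (for i < j, with lam nonvanishing). *)
Definition xicoord x (i j : nat) : R := x i j / (lam i * lam j).

(* On ginf the double series converges absolutely, so summing it along the
   finite index sets i < j < n loses no generality. *)
Definition ip x y : R :=
  limn (fun n : nat =>
    \sum_(j < n) \sum_(i < n | (i < j)%N) xicoord x i j * xicoord y i j).

(* The vector of ginf representing the linear form of the Koszul formula; the
   default value 0 is used only if there is no such vector. *)
Definition nabla x y : infmx R :=
  xget 0 [set v | ginf v /\ forall z, ginf z ->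
    ip v z = 2^-1 * (ip (lie x y) z - ip (lie y z) x + ip (lie z x) y)].

Definition curv x y z : infmx R :=
  nabla (lie x y) z - nabla x (nabla y z) + nabla y (nabla x z).

Definition ricci N x : infmx R :=
  \sum_(j < N) \sum_(i < N | (i < j)%N) curv (xi i j) x (xi i j).

End LieAlgebra.

(* Main.v *)
Require Import Defs.
From mathcomp Require Import all_boot all_order all_algebra.
From mathcomp Require Import all_classical all_reals all_analysis.
From mathcomp Require Import ring lra zify.
Set Implicit Arguments.
Unset Strict Implicit.
Unset Printing Implicit Defensive.
Import Order.TTheory GRing.Theory Num.Theory numFieldNormedType.Exports.
Local Open Scope classical_set_scope.
Local Open Scope ring_scope.

(** On the basis vectors everything is finite and explicit.  A bracket with
    [xi i j] involves a single entry in each matrix product, so the Koszul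
    formula for [x = xi i j] and [y = xi k m], tested against an arbitrary [z],
    is a finite combination of coordinates of [z]; reading it off gives
    [nabla_xi], where the covariant derivative is a multiple of at most one
    [xi p q].

    In particular [nabla x x = 0] for a basis vector [x], and evaluating the
    two other terms of the curvature in each of the possible coincidences among
    [i], [j], [k], [m] shows that [xi k m] is an eigenvector of every
    [x |-> R_{xi i j, x} (xi i j)] ([curv_xi]); the eigenvalue
    [xi_sectional k m i j] is the sectional curvature of the plane spanned by
    [xi i j] and [xi k m].  Hence [xi k m] is an eigenvector of the truncated
    Ricci transformation, with eigenvalue the sum of these curvatures over
    [i < j < N] ([ricci_xi]).

    The divergence comes from the new column [j = N] that appears when [N]
    grows to [N + 1].  When [N > m], exactly two entries of that column meet
    [xi k m]: [xi m N], which does not commute with [xi k m] and contributes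
    [- 3/4 lam m ^+ 4], and [xi k N], which lies in the same row and contributes
    [+ 1/4 lam m ^+ 4].  So the eigenvalue drops by the fixed positive
    amount [lam m ^+ 4 / 2] at every step ([sum_xi_sectional_column]). *)

(** * Sums and limits with a single nonzero term *)

Section SingleTerm.
Context {R : realType}.
Implicit Types (F : nat -> nat -> R) (f : nat -> R).

Lemma limn_series_single f l :
  (forall i, i != l -> f i = 0) -> limn (series f) = f l.
Proof.
move=> f0; apply: lim_near_cst; first exact: norm_hausdorff.
exists l.+1 => // n /= ltln; rewrite /series /= big_mkord.
rewrite (bigD1 (Ordinal ltln)) //= big1 ?addr0// => i neq_il.
by apply: f0; apply: contra neq_il => /eqP eq_il; apply/eqP/val_inj.
Qed.

Lemma sum_lt_narrow f j n : (j <= n)%N ->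
  \sum_(i < n | (i < j)%N) f i = \sum_(i < j) f i.
Proof. by move=> lejn; rewrite (big_ord_narrow (F := fun i : 'I_n => f i)). Qed.

Lemma sum_upper_single F p q n : (p < q < n)%N ->
  (forall i j, (i, j) != (p, q) -> F i j = 0) ->
  \sum_(j < n) \sum_(i < n | (i < j)%N) F i j = F p q.
Proof.
move=> /andP[ltpq ltqn] F0; have ltpn := ltn_trans ltpq ltqn.
rewrite (bigD1 (Ordinal ltqn)) //= (bigD1 (Ordinal ltpn)) //=.
rewrite !big1 ?addr0// => [j neq_jq|i /andP[_ neq_ip]].
  rewrite big1// => i _; apply: F0; apply: contra neq_jq => /eqP[_ eq_jq].
  exact/eqP/val_inj.
apply: F0; apply: contra neq_ip => /eqP[eq_ip]; exact/eqP/val_inj.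
Qed.

End SingleTerm.

Section BasisVectors.
Context {R : realType} (lam : nat -> R) (lam_gt0 : forall i, 0 < lam i).
Implicit Types (v w x y z : infmx R) (i j k m n p q : nat) (a b c r s : R).

Let lam_neq0 i : lam i != 0. Proof. by rewrite gt_eqF. Qed.

(** * Elements of the Lie algebra *)

Lemma infmxD v w i j : (v + w) i j = v i j + w i j. Proof. by []. Qed.

Lemma infmxZ c v i j : (c *: v) i j = c * v i j. Proof. by []. Qed.

Lemma infmxN v i j : (- v) i j = - v i j. Proof. by []. Qed.

Lemma xi_ge i j : (j <= i)%N -> xi lam i j = 0.
Proof. by rewrite /xi ltnNge => ->. Qed.

Lemma xiE i j p q :
  xi lam i j p q = (i < j)%N%:R * (lam i * lam j) * ((p == i) && (q == j))%:R.
Proof. by rewrite /xi; case: ifP => _; rewrite ?mul1r// !mul0r. Qed.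

Lemma xicoord_xi i j p q : (i < j)%N ->
  xicoord lam (xi lam i j) p q = ((p == i) && (q == j))%:R.
Proof.
move=> ltij; rewrite /xicoord xiE ltij mul1r.
case: eqP => [->|_] /=; last by rewrite mulr0 mul0r.
case: eqP => [->|_] /=; last by rewrite mulr0 mul0r.
by rewrite mulr1 divff // mulf_neq0.
Qed.

Lemma ginf_low x i j : ginf lam x -> (j <= i)%N -> x i j = 0.
Proof.
move=> [_ [c _ ->]] leji; apply: lim_near_cst; first exact: norm_hausdorff.
apply: nearW => n; rewrite big1// => q _; rewrite big1// => p ltpq.
rewrite xiE; case: eqP => [eq_ip|_]; last by rewrite !mulr0.
case: eqP => [eq_jq|_]; last by rewrite !mulr0.
by move: ltpq; rewrite -eq_ip -eq_jq ltnNge leji.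
Qed.

(** Finite combinations of the [xi i j] are represented by a common bound on
    their support, which makes membership in [ginf] of such combinations
    immediate. *)
Definition upper_supp n v := forall i j, ~~ (i < j < n)%N -> v i j = 0.

Lemma upper_supp_xi n i j : (j < n)%N -> upper_supp n (xi lam i j).
Proof.
move=> ltjn p q; rewrite xiE; case: eqP => [->|_]; last by rewrite !mulr0.
case: eqP => [->|_]; last by rewrite !mulr0.
by rewrite ltjn andbT => /negPf->; rewrite !mul0r.
Qed.

Lemma upper_suppD n v w : upper_supp n v -> upper_supp n w ->
  upper_supp n (v + w).
Proof.
by move=> hv hw i j h; rewrite infmxD hv// hw// addr0.
Qed.

Lemma upper_suppZ n c v : upper_supp n v -> upper_supp n (c *: v).
Proof. by move=> hv i j h; rewrite infmxZ hv// mulr0. Qed.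

Lemma upper_suppN n v : upper_supp n v -> upper_supp n (- v).
Proof. by move=> hv i j h; rewrite infmxN hv// oppr0. Qed.

Lemma sqsum_on_upper_supp D n v : upper_supp n v -> sqsum_on D v.
Proof.
move=> hv; rewrite /sqsum_on.
pose F : set (nat * nat) := `I_n `*` `I_n.
have finF : finite_set F by apply: finite_setX; exact: finite_II.
pose f (p : nat * nat) : \bar R := ((`|v p.1 p.2| ^+ 2)%:E).
apply: (@le_lt_trans _ _ (\esum_(p in F) f p)%E).
  (* Terms outside the square F vanish, and D need not be contained in F, so
     both sums are extended by zero to all pairs before being compared. *)
  rewrite esum_mkcond [leRHS]esum_mkcond; apply: le_esum => -[p q] _ /=.
  have f_ge0 : (0 <= f (p, q))%E by rewrite lee_fin exprn_ge0.
  case: (boolP ((p, q) \in F)) => [_|/negP notF]; first by case: ifP.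
  suff -> : ((`|v p q| ^+ 2)%:E = 0 :> \bar R)%E by case: ifP.
  rewrite hv ?normr0 ?expr0n//; apply/negP => /andP[ltpq ltqn]; apply: notF.
  by apply/mem_set; split => //=; exact: ltn_trans ltqn.
rewrite esum_fset// => [|p _]; last by rewrite lee_fin exprn_ge0.
by rewrite fsbig_finite//= sumEFin ltry.
Qed.

Lemma ginf_upper_supp n v : upper_supp n v -> ginf lam v.
Proof.
move=> hv; split; first exact: sqsum_on_upper_supp hv.
have hc : upper_supp n (xicoord lam v).
  by move=> i j h; rewrite /xicoord hv// mul0r.
exists (xicoord lam v); first exact: sqsum_on_upper_supp hc.
apply/funext => p; apply/funext => q; apply/esym.
apply: lim_near_cst; first exact: norm_hausdorff.
exists n => // N /= lenN.
have [/andP[ltpq ltqn]|h] := boolP (p < q < n)%N.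
  pose F i j := xicoord lam v i j * xi lam i j p q.
  rewrite (@sum_upper_single _ F p q); first last.
  - move=> i j neq; rewrite /F xiE; case: eqP => [eip|_]; last by rewrite !mulr0.
    case: eqP => [ejq|_]; last by rewrite !mulr0.
    by rewrite eip ejq eqxx in neq.
  - by rewrite ltpq (leq_trans ltqn).
  by rewrite /F xiE ltpq !eqxx mul1r mulr1 /xicoord divfK// mulf_neq0.
rewrite hv// big1// => j _; rewrite big1// => i ltij.
have [[<- <-]|neq] := eqVneq (p, q) (nat_of_ord i, nat_of_ord j).
  by rewrite hc// mul0r.
by rewrite xiE; move: neq; rewrite xpair_eqE => /negPf->; rewrite !mulr0.
Qed.

Lemma ginf_xi i j : ginf lam (xi lam i j).
Proof. exact/(@ginf_upper_supp j.+1)/upper_supp_xi. Qed.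

(** * The inner product *)

(** The value of [ip] as an eventually constant sequence of partial sums.
    Unlike [ip] itself, which is a limit that may fail to exist, this relation
    is additive in its first argument unconditionally. *)
Definition ip_eventually v z r := \forall n \near \oo,
  \sum_(j < n) \sum_(i < n | (i < j)%N)
     xicoord lam v i j * xicoord lam z i j = r.

Lemma ip_eventuallyE v z r : ip_eventually v z r -> ip lam v z = r.
Proof. by apply: lim_near_cst; exact: norm_hausdorff. Qed.

Lemma ip_eventuallyD v w z r s : ip_eventually v z r -> ip_eventually w z s ->
  ip_eventually (v + w) z (r + s).
Proof.
apply: filterS2 => n <- <-; rewrite -big_split; apply: eq_bigr => j _ /=.
rewrite -big_split; apply: eq_bigr => i _ /=.
by rewrite /xicoord infmxD !mulrDl.
Qed.

Lemma ip_eventuallyZ c v z r : ip_eventually v z r ->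
  ip_eventually (c *: v) z (c * r).
Proof.
apply: filterS => n <-; rewrite mulr_sumr; apply: eq_bigr => j _ /=.
rewrite mulr_sumr; apply: eq_bigr => i _ /=.
by rewrite /xicoord infmxZ !mulrA.
Qed.

Lemma ip_eventuallyN v z r : ip_eventually v z r -> ip_eventually (- v) z (- r).
Proof. by rewrite -scaleN1r -(mulN1r r); exact: ip_eventuallyZ. Qed.

Lemma ip_eventually_xi i j z : (i < j)%N ->
  ip_eventually (xi lam i j) z (xicoord lam z i j).
Proof.
move=> ltij; exists j.+1 => // n /= ltjn.
pose F p q := xicoord lam (xi lam i j) p q * xicoord lam z p q.
rewrite (@sum_upper_single _ F i j) ?ltij//; last first.
  move=> p q; rewrite /F xicoord_xi// => neq.
  by move: neq; rewrite xpair_eqE => /negPf->; rewrite mul0r.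
by rewrite /F xicoord_xi// !eqxx mul1r.
Qed.

(** The strict inequality can be dropped for [z] in [ginf]: both sides vanish
    when [j <= i].  This is what lets the convention [xi i j = 0] replace a case
    distinction in the Koszul formula. *)
Lemma ip_eventually_xi_ginf i j z : ginf lam z ->
  ip_eventually (xi lam i j) z (xicoord lam z i j).
Proof.
move=> gz; case: (ltnP i j) => [|leji]; first exact: ip_eventually_xi.
rewrite /xicoord (ginf_low gz leji) mul0r xi_ge//.
apply: nearW => n; rewrite big1// => q _; rewrite big1// => p _.
by rewrite /xicoord mul0r mul0r.
Qed.

Lemma ipC v z : ip lam v z = ip lam z v.
Proof.
rewrite /ip; congr (limn _); apply/funext => n.
by apply: eq_bigr => j _; apply: eq_bigr => i _; rewrite mulrC.
Qed.

Lemma ip_xi_r c i j w : (i < j)%N ->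
  ip lam w (c *: xi lam i j) = c * xicoord lam w i j.
Proof.
move=> ltij; rewrite ipC.
exact/ip_eventuallyE/ip_eventuallyZ/ip_eventually_xi.
Qed.

(** Nondegeneracy: testing against [xi i j] isolates the entry at [i], [j]. *)
Lemma ginf_ip_inj v w : ginf lam v -> ginf lam w ->
  (forall z, ginf lam z -> ip lam v z = ip lam w z) -> v = w.
Proof.
move=> gv gw vw; apply/funext => i; apply/funext => j.
case: (ltnP i j) => [ltij|leji]; last by rewrite !(@ginf_low _ i j).
have := vw _ (ginf_xi i j); rewrite -[xi lam i j]scale1r !ip_xi_r// !mul1r.
by move=> /mulIf; apply; rewrite invr_eq0 mulf_neq0.
Qed.

(** * Brackets and the connection on basis vectors *)

(** [xi i j] has one nonzero entry, so each of the two matrix products with it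
    reduces to one term of the defining series. *)
Lemma xicoord_lie_xi c i j z p q : (i < j)%N ->
  xicoord lam (lie (c *: xi lam i j) z) p q =
  c * ((p == i)%:R * lam j ^+ 2 * xicoord lam z j q
     - (q == j)%:R * lam i ^+ 2 * xicoord lam z p i).
Proof.
move=> ltij; rewrite /xicoord /lie infmxD infmxN /mxprod.
have cxiE p' q' : (c *: xi lam i j) p' q' =
    c * (lam i * lam j) * ((p' == i) && (q' == j))%:R.
  by rewrite infmxZ xiE ltij mul1r mulrA.
rewrite (limn_series_single (l := j)); last first.
  by move=> l /negPf nlj; rewrite cxiE nlj andbF mulr0 mul0r.
rewrite (limn_series_single (l := i)); last first.
  by move=> l /negPf nli; rewrite cxiE nli /= !mulr0.
rewrite !cxiE !eqxx andbT /=.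
by case: (eqVneq p i) => [->|_]; case: (eqVneq q j) => [->|_] /=; field;
  rewrite !lam_neq0.
Qed.

Lemma lie_antisym x y : lie x y = - lie y x.
Proof. by rewrite /lie opprB. Qed.

Lemma xicoordN v p q : xicoord lam (- v) p q = - xicoord lam v p q.
Proof. by rewrite /xicoord infmxN mulNr. Qed.

Lemma xicoord_eq v w : (forall p q, xicoord lam v p q = xicoord lam w p q) ->
  v = w.
Proof.
move=> vw; apply/funext => p; apply/funext => q; have /mulIf := vw p q.
by apply; rewrite invr_eq0 mulf_neq0.
Qed.

Lemma lie_xi i j k m : (i < j)%N -> (k < m)%N ->
  lie (xi lam i j) (xi lam k m) =
  ((j == k)%:R * lam j ^+ 2) *: xi lam i m
  - ((i == m)%:R * lam i ^+ 2) *: xi lam k j.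
Proof.
move=> ltij ltkm; apply: xicoord_eq => p q.
rewrite -[xi lam i j]scale1r xicoord_lie_xi// mul1r !xicoord_xi//.
rewrite /xicoord infmxD infmxN !infmxZ !xiE.
have [ejk|_] := eqVneq j k; have [eim|_] := eqVneq i m;
  try (by exfalso; lia); subst=> /=.
- rewrite (ltn_trans ltij ltkm) /= andbF !mulr0.
  by case: (eqVneq p i) => [->|_]; case: (eqVneq q m) => [->|_] /=; field;
    rewrite !lam_neq0.
- rewrite (ltn_trans ltkm ltij) /= andbT !mul0r.
  by case: (eqVneq p k) => [->|_]; case: (eqVneq q j) => [->|_] /=; field;
    rewrite !lam_neq0.
- by rewrite !(mul0r, mulr0, subrr, andbF).
Qed.

(** The Koszul formula for [xi i j] and [xi k m], multiplied by two.  The first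
    parenthesis is the bracket; the others are the adjoints of [ad (xi k m)] and
    [ad (xi i j)] applied to [xi i j] and [xi k m].  In each of them at most
    one summand is nonzero, by the convention [xi p q = 0] for [q <= p]. *)
Definition nabla_xi_twice i j k m : infmx R :=
  (((j == k)%:R * lam j ^+ 2) *: xi lam i m
    - ((i == m)%:R * lam i ^+ 2) *: xi lam k j)
  - (i == k)%:R *: (lam m ^+ 2 *: xi lam m j + lam j ^+ 2 *: xi lam j m)
  + (j == m)%:R *: (lam k ^+ 2 *: xi lam i k + lam i ^+ 2 *: xi lam k i).

Lemma nabla_unique x y v : ginf lam v ->
  (forall z, ginf lam z -> ip lam v z =
    2^-1 * (ip lam (lie x y) z - ip lam (lie y z) x + ip lam (lie z x) y)) ->
  nabla lam x y = v.
Proof.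
move=> gv hv; rewrite /nabla; case: xgetP => [w -> [gw hw]|].
  by apply: ginf_ip_inj => // z gz; rewrite hw// hv.
by move=> /(_ v) [].
Qed.

Lemma lieZ2 r s i j k m : (i < j)%N -> (k < m)%N ->
  lie (r *: xi lam i j) (s *: xi lam k m) =
  (r * s) *: lie (xi lam i j) (xi lam k m).
Proof.
move=> ltij ltkm; apply: xicoord_eq => p q.
rewrite [RHS]/xicoord infmxZ -mulrA -/(xicoord lam _ p q).
rewrite -[X in lie X (xi lam k m)]scale1r !xicoord_lie_xi//.
by rewrite /xicoord !infmxZ; ring.
Qed.

(** The vector [nabla_xi_twice i j k m] is obtained by moving, in each term of
    the Koszul formula, the bracket with a basis vector off [z].  The scalars
    are carried along because iterated covariant derivatives of basis vectors
    are multiples of basis vectors. *)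
Lemma nabla_xi r s i j k m : (i < j)%N -> (k < m)%N ->
  nabla lam (r *: xi lam i j) (s *: xi lam k m) =
  (r * s / 2) *: nabla_xi_twice i j k m.
Proof.
move=> ltij ltkm; apply: nabla_unique.
  pose n := (maxn j m).+1.
  apply/(@ginf_upper_supp n)/upper_suppZ; rewrite /nabla_xi_twice.
  by repeat first [apply: upper_suppD | apply: upper_suppN
    | apply: upper_suppZ | apply: upper_supp_xi; rewrite /n; lia].
move=> z gz.
(* Both inner products with z, of the claimed derivative and of the bracket,
   are sums over the displayed combinations of basis vectors, in this order. *)
have xiP p q := ip_eventually_xi_ginf p q gz.
rewrite lieZ2// lie_xi//.
rewrite (ip_eventuallyE (ip_eventuallyZ (r * s / 2) (ip_eventuallyD
  (ip_eventuallyD (ip_eventuallyD (ip_eventuallyZ _ (xiP i m))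
    (ip_eventuallyN (ip_eventuallyZ _ (xiP k j))))
    (ip_eventuallyN (ip_eventuallyZ _ (ip_eventuallyD
      (ip_eventuallyZ _ (xiP m j)) (ip_eventuallyZ _ (xiP j m))))))
   (ip_eventuallyZ _ (ip_eventuallyD
      (ip_eventuallyZ _ (xiP i k)) (ip_eventuallyZ _ (xiP k i))))))).
rewrite (ip_eventuallyE (ip_eventuallyZ (r * s) (ip_eventuallyD
  (ip_eventuallyZ _ (xiP i m)) (ip_eventuallyN (ip_eventuallyZ _ (xiP k j)))))).
rewrite (lie_antisym z) !ip_xi_r// xicoordN !xicoord_lie_xi//.
rewrite (eq_sym k i) (eq_sym m j).
by field.
Qed.

Lemma nabla_xi1 i j k m : (i < j)%N -> (k < m)%N ->
  nabla lam (xi lam i j) (xi lam k m) = 2^-1 *: nabla_xi_twice i j k m.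
Proof.
move=> ltij ltkm; rewrite -[xi lam i j]scale1r -[xi lam k m]scale1r nabla_xi//.
by rewrite !mul1r.
Qed.

Lemma nabla_xil r i j k m : (i < j)%N -> (k < m)%N ->
  nabla lam (r *: xi lam i j) (xi lam k m) = (r / 2) *: nabla_xi_twice i j k m.
Proof. by move=> ltij ltkm; rewrite -[xi lam k m]scale1r nabla_xi// mulr1. Qed.

Lemma nabla_xir r i j k m : (i < j)%N -> (k < m)%N ->
  nabla lam (xi lam i j) (r *: xi lam k m) = (r / 2) *: nabla_xi_twice i j k m.
Proof. by move=> ltij ltkm; rewrite -[xi lam i j]scale1r nabla_xi// mul1r. Qed.

Lemma nabla0l i j : (i < j)%N -> nabla lam 0 (xi lam i j) = 0.
Proof.
by move=> ltij; rewrite -(scale0r (xi lam i j)) nabla_xil// mul0r !scale0r.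
Qed.

Lemma nabla0r i j : (i < j)%N -> nabla lam (xi lam i j) 0 = 0.
Proof.
by move=> ltij; rewrite -(scale0r (xi lam i j)) nabla_xir// mul0r !scale0r.
Qed.

(** A basis vector is orthogonal to its brackets, so its one-parameter
    subgroup is a geodesic; this removes the last term of the curvature. *)
Lemma nabla_xi_self i j : (i < j)%N -> nabla lam (xi lam i j) (xi lam i j) = 0.
Proof.
move=> ltij; rewrite nabla_xi1// /nabla_xi_twice.
have -> : (j == i) = false by rewrite gtn_eqF.
have -> : (i == j) = false by rewrite ltn_eqF.
rewrite !eqxx !(xi_ge (leqnn _)).
by rewrite !(mul0r, scale0r, scaler0, addr0, subrr).
Qed.

(** * Curvature *)

(** The sectional curvature of the plane spanned by [xi i j] and [xi k m], zero
    when the two vectors coincide.  The first two cases are the noncommuting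
    pairs; in the next two the vectors share a row or a column. *)
Definition xi_sectional k m i j : R :=
  if j == k then - 3 / 4 * lam k ^+ 4
  else if i == m then - 3 / 4 * lam m ^+ 4
  else if i == k then
    (if (j < m)%N then lam j ^+ 4 / 4
     else if (m < j)%N then lam m ^+ 4 / 4 else 0)
  else if j == m then
    (if (i < k)%N then lam k ^+ 4 / 4 else lam i ^+ 4 / 4)
  else 0.

Let xiZN r i j : - (r *: xi lam i j) = (- r) *: xi lam i j.
Proof. by rewrite scaleNr. Qed.

Let xiZA r s i j : r *: (s *: xi lam i j) = (r * s) *: xi lam i j.
Proof. by rewrite scalerA. Qed.

(** Decides by linear arithmetic the Kronecker symbols between indices whose
    order is known. *)
Ltac decide_eqs := repeat match goal with
  | |- context [?i == ?i :> nat] => rewrite (eqxx i)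
  | |- context [@eq_op ?T ?i ?j] =>
     first [have -> : (i == j :> nat) = false by lia
           |have -> : (i == j :> nat) = true by lia]
  end.

Ltac simp_nabla := rewrite /nabla_xi_twice; decide_eqs;
  repeat match goal with |- context [xi lam ?i ?j] =>
    rewrite (@xi_ge i j); last lia end;
  rewrite /= ?(mul0r, mul1r, scale0r, scale1r, scaler0, oppr0, sub0r, subr0,
           addr0, add0r, xiZN, xiZA).

(** Conjugation by a diagonal matrix of signs [eps] preserves bracket and inner
    product and multiplies [xi p q] by [eps p * eps q].  As [xi i j] occurs twice
    in the curvature, the signs of the result are those of [xi k m], which no
    other basis vector has.  The term in [nabla e e], [e = xi i j], vanishes, so
    only two iterated derivatives remain to be computed. *)
Lemma curv_xi i j k m : (i < j)%N -> (k < m)%N ->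
  curv lam (xi lam i j) (xi lam k m) (xi lam i j) =
  xi_sectional k m i j *: xi lam k m.
Proof.
move=> ltij ltkm; rewrite /curv nabla_xi_self// nabla0r// addr0 lie_xi//.
rewrite (nabla_xi1 ltkm ltij) /xi_sectional.
have [ejk|njk] := eqVneq j k.
  subst j; simp_nabla; rewrite nabla_xil ?nabla_xir//; try lia.
  simp_nabla; rewrite -scalerDl; congr (_ *: _); by field.
have [eim|nim] := eqVneq i m.
  subst i; simp_nabla; rewrite nabla_xil ?nabla_xir//; try lia.
  simp_nabla; rewrite -scalerDl; congr (_ *: _); by field.
have [eik|nik] := eqVneq i k.
  subst i; case: ltngtP => [ltjm|ltmj|ejm].
  - simp_nabla; rewrite nabla0l ?nabla_xir//; try lia.
    simp_nabla; congr (_ *: _); by field.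
  - simp_nabla; rewrite nabla0l ?nabla_xir//; try lia.
    simp_nabla; congr (_ *: _); by field.
  - by subst j; simp_nabla; rewrite nabla0l ?nabla0r// !subr0.
have [ejm|njm] := eqVneq j m.
  subst j; case: ltngtP => [ltjm|ltmj|ejm].
  - simp_nabla; rewrite nabla0l ?nabla_xir//; try lia.
    simp_nabla; congr (_ *: _); by field.
  - simp_nabla; rewrite nabla0l ?nabla_xir//; try lia.
    simp_nabla; congr (_ *: _); by field.
  - by rewrite ejm eqxx in nik.
by simp_nabla; rewrite nabla0l// nabla0r// subr0.
Qed.

Lemma ricci_xi N k m : (k < m)%N -> ricci lam N (xi lam k m) =
  (\sum_(j < N) \sum_(i < j) xi_sectional k m i j) *: xi lam k m.
Proof.
move=> ltkm; rewrite /ricci scaler_suml; apply: eq_bigr => j _.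
rewrite -(sum_lt_narrow (fun i => xi_sectional k m i j) (ltnW (ltn_ord j))).
rewrite scaler_suml.
by apply: eq_bigr => i ltij; rewrite curv_xi.
Qed.

(** In column [N] only the rows [k] and [m] contribute, with [1/4] and [- 3/4]
    of [lam m ^+ 4]. *)
Lemma sum_xi_sectional_column N k m : (k < m < N)%N ->
  \sum_(i < N) xi_sectional k m i N = - lam m ^+ 4 / 2.
Proof.
move=> /andP[ltkm ltmN]; have ltkN := ltn_trans ltkm ltmN.
rewrite (bigD1 (Ordinal ltkN))//= (bigD1 (Ordinal ltmN))/=; last first.
  by apply/eqP => -[]; lia.
rewrite big1 => [|i /andP[nik nim]]; last first.
  have {}nik : (i == k :> nat) = false.
    by apply: contraNF nik => /eqP eik; exact/eqP/val_inj.
  have {}nim : (i == m :> nat) = false.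
    by apply: contraNF nim => /eqP eim; exact/eqP/val_inj.
  by rewrite /xi_sectional nik nim; decide_eqs.
rewrite /xi_sectional; decide_eqs; rewrite ltmN ltnNge (ltnW ltmN) /=; by field.
Qed.

End BasisVectors.

Theorem corollary6p11 (R : realType) (lam : nat -> R)
    (lam_gt0 : forall i : nat, 0 < lam i)
    (lam_l2 : cvgn (series (fun i : nat => lam i ^+ 2)))
    (k m : nat) (lt_km : (k < m)%N) :
  exists b : nat -> R,
    (\forall N \near \oo, ricci lam N (xi lam k m) = b N *: xi lam k m) /\
    b N @[N --> \oo] --> -oo%R.
Proof.
pose b N : R := \sum_(j < N) \sum_(i < j) xi_sectional lam k m i j.
exists b; split; first by apply: nearW => N; exact: ricci_xi.
have lam4_gt0 : 0 < lam m ^+ 4 / 2 by rewrite divr_gt0 ?exprn_gt0.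
have bE n : b (m.+1 + n)%N = b m.+1 - n%:R * (lam m ^+ 4 / 2).
  elim: n => [|n IHn]; first by rewrite addn0 mul0r subr0.
  rewrite addnS [b _.+1]big_ord_recr /= -/(b _) IHn.
  rewrite sum_xi_sectional_column; last lia.
  by rewrite -natr1; ring.
apply/cvgrNyPle => A.
have : \forall n \near \oo, (b m.+1 - A) / (lam m ^+ 4 / 2) <= n%:R.
  by have /cvgryPge := @cvgr_idn R; apply.
move=> [n0 _ hn0]; exists (m.+1 + n0)%N => // N /= leN.
have -> : N = (m.+1 + (N - m.+1))%N by lia.
rewrite bE lerBlDr addrC -lerBlDr -ler_pdivrMr//.
by apply: hn0 => /=; lia.
Qed.
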